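(* Let $(X,\triangleright_{z_{ij}})$ be a $p$-shelf with parameter set $Y\subseteq X$, and let $\sigma_a^{z_{ij}},\tau_b^{z_{ij}}:X\to X$ be maps such that, for all $a,b\in X$, $z_i,z_j\in Y$, $\sigma_a^{z_{ij}}$ is a bijection and $\tau_b^{z_{ij}}(a)=\big(\sigma^{z_{ji}}_{\sigma_a^{z_{ij}}(b)}\big)^{-1}\big(\sigma_a^{z_{ij}}(b)\triangleright_{z_{ij}}a\big)$. Moreover, let $(X,\circ)$ be a group such that $a\circ b=\sigma_a^{z_{ij}}(b)\circ\tau_b^{z_{ij}}(a)$ for all $a,b\in X$, $z_i,z_j\in Y$, and define $\bullet_{z_{ij}}:X\times X\to X$ by $a\bullet_{z_{ji}}b:=a\circ(\sigma_a^{z_{ij}})^{-1}(b)\circ h(z_{ij})$ for all $a,b\in X$, $z_i,z_j\in Y$, where $h:Y\times Y\to Y$ is a symmetric function. Then: (1) For all $a,b\in X$, $z_i,z_j\in Y$: (a) $a\bullet_{z_{ji}}b=b\bullet_{z_{ij}}(b\triangleright_{z_{ij}}a)$; (b) $a\bullet_{z_{ji}}\sigma_a^{z_{ij}}(b)=a\circ b\circ h(z_{ij})$. (2) Assume that $(X,+,\circ)$ is a skew brace, $Y\subseteq\mathcal{D}(X)\cap Z(X,+)$, and $z_i\circ z_j=z_j\circ z_i$ for all $z_i,z_j\in Y$. Suppose that $a\bullet_{z_{ij}}b=a\circ z_i+b\circ z_j$ and $h(z_{ij})=z_i\circ z_j$ for all $a,b\in X$, $z_i,z_j\in Y$. Then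 for all $a,b,c\in X$, $z_i,z_j,z_k\in Y$: (a) $b\triangleright_{z_{ij}}a=-b\circ z_i\circ z_j^{-1}+a+b\circ z_i\circ z_j^{-1}$ and $\sigma_a^{z_{ij}}(b)=z_i^{-1}-a\circ z_i^{-1}\circ z_j+a\circ b\circ z_j$; (b) $\sigma_a^{z_{ik}}(\sigma_b^{z_{ij}}(c))=\sigma^{z_{ij}}_{\sigma_a^{z_{jk}}(b)}\big(\sigma^{z_{ik}}_{\tau_b^{z_{jk}}(a)}(c)\big)$ and $\sigma_c^{z_{ik}}(b)\triangleright_{z_{ij}}\sigma_c^{z_{jk}}(a)=\sigma_c^{z_{jk}}(b\triangleright_{z_{ij}}a)$, i.e. $\sigma_a^{z_{ij}}$ provides an admissible twist.
   Context: $z_{ij}$ denotes dependence on the ordered pair $(z_i,z_j)\in Y\times Y$. $(X,\triangleright_{z_{ij}})$ is a $p$-shelf if $a\triangleright_{z_{ik}}(b\triangleright_{z_{jk}}c)=(a\triangleright_{z_{ij}}b)\triangleright_{z_{jk}}(a\triangleright_{z_{ik}}c)$ for all $a,b,c\in X$, $z_i,z_j,z_k\in Y$. A map $h:Y\times Y\to Y$, $(z_i,z_j)\mapsto h(z_{ij})$, is symmetric if $h(z_{ij})=h(z_{ji})$. In part (2), where $h(z_{ij})=z_i\circ z_j$, it is understood that $z_i\circ z_j\in Y$. A skew brace (skew left brace) is a set $X$ with two group operations $+,\circ$ (with $+$ not necessarily commutative) such that $a\circ(b+c)=a\circ b-a+a\circ c$ for all $a,b,c$; $a^{-1}$ denotes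 the inverse in $(X,\circ)$. $\mathcal{D}(X)=\{z\in X\mid (a+b)\circ z=a\circ z-z+b\circ z\ \ \forall a,b\in X\}$ is its right distributor and $Z(X,+)$ is the center of $(X,+)$. Expressions like $-b\circ z\circ w$ mean $-(b\circ z\circ w)$. A map $\varphi^{z_{ij}}(a,b)=(a,\sigma_a^{z_{ji}}(b))$ on $X\times X$ with all $\sigma_a^{z_{ij}}$ bijective is an admissible twist for the $p$-shelf $(X,\triangleright_{z_{ij}})$ if the two identities displayed in (2)(b) hold for all $a,b,c\in X$ and $z_i,z_j,z_k\in Y$, with $\tau_b^{z_{ij}}(a)$ as in the claim. *)

(* Defs.v *)
From HB Require Import structures.
From mathcomp Require Import all_boot.
From mathcomp Require Import boolp classical_sets functions.

Set Implicit Arguments.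
Unset Strict Implicit.
Unset Printing Implicit Defensive.

Local Open Scope classical_set_scope.
Local Open Scope group_scope.

(* A total function, the two-sided inverse of f when f is bijective. *)
Definition inv_map (X : Type) (f : X -> X) : X -> X := 'pinv_id setT f.

Lemma inv_mapK (X : Type) (f : X -> X) :
  bijective f -> cancel f (inv_map f) /\ cancel (inv_map f) f.
Proof.
move=> fb; split=> x.
  by apply: pinvKV; rewrite ?inE // => a b _ _; exact: (bij_inj fb).
by apply: pinvK; rewrite inE; case: fb => g _ gf; exists (g x).
Qed.

(* Families indexed by (z_i, z_j) in Y x Y are curried functions on the type of
   elements of Y: [tri zi zj a b] is $a \triangleright_{z_{ij}} b$ and
   [sigma zi zj a b] is $\sigma_a^{z_{ij}}(b)$. *)

Definition p_shelf (X : Type) (Y : set X) (tri : Y -> Y -> X -> X -> X) : Prop :=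
  forall (zi zj zk : Y) (a b c : X),
    tri zi zk a (tri zj zk b c) = tri zj zk (tri zi zj a b) (tri zi zk a c).

(* [twist_tau tri sigma zi zj b a] is $\tau_b^{z_{ij}}(a)$. *)
Definition twist_tau (X : Type) (Y : set X) (tri sigma : Y -> Y -> X -> X -> X)
    (zi zj : Y) (b a : X) : X :=
  inv_map (sigma zj zi (sigma zi zj a b)) (tri zi zj (sigma zi zj a b) a).

Definition twist_map (X : Type) (Y : set X) (sigma : Y -> Y -> X -> X -> X)
    (zi zj : Y) (p : X * X) : X * X :=
  (p.1, sigma zj zi p.1 p.2).

(* phi determines sigma, so the existential quantifier only recovers the
   family sigma from phi. *)
Definition admissible_twist (X : Type) (Y : set X)
    (tri : Y -> Y -> X -> X -> X) (phi : Y -> Y -> X * X -> X * X) : Prop :=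
  exists sigma : Y -> Y -> X -> X -> X,
    [/\ phi = twist_map sigma,
        forall (zi zj : Y) (a : X), bijective (sigma zi zj a),
        forall (zi zj zk : Y) (a b c : X),
          sigma zi zk a (sigma zi zj b c) =
          sigma zi zj (sigma zj zk a b)
            (sigma zi zk (twist_tau tri sigma zj zk b a) c) &
        forall (zi zj zk : Y) (a b c : X),
          tri zi zj (sigma zi zk c b) (sigma zj zk c a) =
          sigma zj zk c (tri zi zj b a)].

(* A skew left brace whose circle group is the given group X, so that
   [x * y] and [x^-1] are $x \circ y$ and $x^{-1}$. The additive group is a
   field of the record because it need not be commutative, unlike the
   additive groups of the library. *)
Record skew_brace (X : groupType) : Type := SkewBrace {
  sb_add : X -> X -> X;
  sb_zero : X;
  sb_opp : X -> X;
  sb_addA : associative sb_add;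
  sb_add0 : left_id sb_zero sb_add;
  sb_addN : left_inverse sb_zero sb_opp sb_add;
  sb_law : forall a b c : X,
    a * sb_add b c = sb_add (sb_add (a * b) (sb_opp a)) (a * c)
}.

Notation "a +[ B ] b" := (sb_add B a b)
  (at level 50, B at level 200, left associativity,
   format "a  +[ B ]  b") : group_scope.
Notation "-[ B ] a" := (sb_opp B a)
  (at level 35, B at level 200, right associativity,
   format "-[ B ]  a") : group_scope.
Notation "a -[ B ] b" := (sb_add B a (sb_opp B b))
  (at level 50, B at level 200, left associativity,
   format "a  -[ B ]  b") : group_scope.

Definition right_distributor (X : groupType) (B : skew_brace X) : set X :=
  [set z | forall a b : X, (a +[B] b) * z = a * z -[B] z +[B] b * z].

Definition add_center (X : groupType) (B : skew_brace X) : set X :=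
  [set z | forall a : X, z +[B] a = a +[B] z].

(* Main.v *)
(* A map f on (X, +) preserving the ternary operation p - q + r is here called a
   heap morphism.  In a skew brace left multiplications are heap morphisms, and
   so is right multiplication by z exactly when z is right distributive;
   in this form closure under composition and inverses is immediate, and so is
   the fact that a bijective heap morphism preserves centrality of differences.
   Part (2) then follows by distributing products over p - q + r and moving
   central terms. *)
Require Import Defs.
From HB Require Import structures.
From mathcomp Require Import all_boot.
From mathcomp Require Import boolp classical_sets functions.

Local Open Scope classical_set_scope.
Local Open Scope group_scope.

Lemma sb_addrN (X : groupType) (B : skew_brace X) (a : X) :
  a -[B] a = sb_zero B.
Proof.
rewrite - [LHS](sb_add0 B) -{1}(sb_addN B (-[B] a)) -sb_addA.
by rewrite (sb_addA B (-[B] a) a) sb_addN sb_add0 sb_addN.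
Qed.

Lemma sb_addr0 (X : groupType) (B : skew_brace X) (a : X) :
  a +[B] sb_zero B = a.
Proof. by rewrite -(sb_addN B a) sb_addA sb_addrN sb_add0. Qed.

Lemma sb_addrK (X : groupType) (B : skew_brace X) (x a : X) :
  x +[B] a -[B] a = x.
Proof. by rewrite -sb_addA sb_addrN sb_addr0. Qed.

Lemma sb_addrNK (X : groupType) (B : skew_brace X) (x a : X) :
  x -[B] a +[B] a = x.
Proof. by rewrite -sb_addA sb_addN sb_addr0. Qed.

Lemma sb_addIr (X : groupType) (B : skew_brace X) (a : X) :
  injective (fun x => x +[B] a).
Proof. by move=> x y /= e; rewrite -(sb_addrK X B x a) e sb_addrK. Qed.

Lemma sb_addrI (X : groupType) (B : skew_brace X) (a : X) :
  injective (sb_add B a).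
Proof.
move=> x y /(congr1 (sb_add B (-[B] a))).
by rewrite !sb_addA sb_addN !sb_add0.
Qed.

Lemma sb_oppK (X : groupType) (B : skew_brace X) (a : X) :
  -[B] (-[B] a) = a.
Proof. by apply: (sb_addIr X B (-[B] a)); rewrite sb_addN sb_addrN. Qed.

Lemma sb_oppD (X : groupType) (B : skew_brace X) (a b : X) :
  -[B] (a +[B] b) = -[B] b -[B] a.
Proof.
apply: (sb_addIr X B (a +[B] b)).
by rewrite sb_addN sb_addA sb_addrNK sb_addN.
Qed.

Lemma sb_oppr0 (X : groupType) (B : skew_brace X) :
  -[B] (sb_zero B) = sb_zero B.
Proof. by rewrite - [LHS](sb_add0 B) sb_addrN. Qed.

(** The brace law at [1], 0, 0 collapses to 0 = -1. *)
Lemma sb_zeroE (X : groupType) (B : skew_brace X) : sb_zero B = 1.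
Proof.
have := sb_law B 1 (sb_zero B) (sb_zero B).
rewrite !mul1g !sb_add0 sb_addr0 => e.
by rewrite - [RHS](sb_add0 B) {2}e sb_addN.
Qed.

(** Normalises additive words: sums associate to the left, opposites move onto the summands,
    adjacent inverses cancel. *)
Definition sb_addE (X : groupType) (B : skew_brace X) :=
  (sb_addA B, sb_oppD X B, sb_oppK X B, sb_addrK X B, sb_addrNK X B,
   sb_addrN X B, sb_addN B, sb_oppr0 X B, sb_addr0 X B, sb_add0 B).

Definition heap_morphism (X : groupType) (B : skew_brace X) (f : X -> X) :=
  forall p q r : X, f (p -[B] q +[B] r) = f p -[B] f q +[B] f r.

Lemma heap_morphism_comp (X : groupType) (B : skew_brace X) (f g : X -> X) :
  heap_morphism X B f -> heap_morphism X B g -> heap_morphism X B (g \o f).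
Proof. by move=> hf hg p q r /=; rewrite hf hg. Qed.

Lemma heap_morphism_can (X : groupType) (B : skew_brace X) (f g : X -> X) :
  cancel f g -> cancel g f -> heap_morphism X B f -> heap_morphism X B g.
Proof.
by move=> fK gK hf p q r; rewrite -{1}(gK p) -{1}(gK q) -{1}(gK r) -hf fK.
Qed.

(** Both the brace law and right distributivity have this shape. Taking [-a] and [a] as summands
    yields f(-a) = f(1) - f(a) + f(1), and then every f(1) cancels. *)
Lemma heap_morphism_affine (X : groupType) (B : skew_brace X) (f : X -> X) :
  (forall a b : X, f (a +[B] b) = f a -[B] f 1 +[B] f b) ->
  heap_morphism X B f.
Proof.
move=> fD p q r.
have fN a : f (-[B] a) = f 1 -[B] f a +[B] f 1.
  have := fD (-[B] a) a.
  by rewrite sb_addN sb_zeroE => {1}->; rewrite !sb_addE.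
by rewrite !fD fN !sb_addE.
Qed.

Lemma heap_morphism_mull (X : groupType) (B : skew_brace X) (c : X) :
  heap_morphism X B (mul c).
Proof. by apply: heap_morphism_affine => a b; rewrite sb_law mulg1. Qed.

Lemma heap_morphism_mulr (X : groupType) (B : skew_brace X) (z : X) :
  right_distributor B z -> heap_morphism X B (fun x => x * z).
Proof. by move=> Dz; apply: heap_morphism_affine => a b; rewrite Dz mul1g. Qed.

Lemma heap_morphism_mulrV (X : groupType) (B : skew_brace X) (z : X) :
  right_distributor B z -> heap_morphism X B (fun x => x * z^-1).
Proof.
move=> /heap_morphism_mulr; apply: heap_morphism_can => x.
  exact: mulgK.
exact: mulgVK.
Qed.

Lemma add_center_opp (X : groupType) (B : skew_brace X) (x : X) :
  add_center B x -> add_center B (-[B] x).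
Proof.
move=> Cx t; apply: (sb_addrI X B x); apply: (sb_addIr X B x).
by rewrite /= !sb_addE Cx.
Qed.

(** Centrality of x - y gives x - y + s = s - y + x for all s. A heap morphism transports this
    identity, and by surjectivity f(s) can be any t + f(y). *)
Lemma heap_morphism_center (X : groupType) (B : skew_brace X) (f : X -> X)
    (x y : X) :
  bijective f -> heap_morphism X B f ->
  add_center B (x -[B] y) -> add_center B (f x -[B] f y).
Proof.
move=> [g _ gK] hf Cxy t; apply: (sb_addIr X B (f y)) => /=.
have e s : x -[B] y +[B] s = s -[B] y +[B] x.
  have xE : x = y +[B] x -[B] y by rewrite -sb_addA -Cxy sb_addrNK.
  by rewrite Cxy sb_addA {2}xE !sb_addE.
have := hf x y (g (t +[B] f y)); rewrite e hf gK.
by rewrite !sb_addE => <-.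
Qed.

(** Right multiplication by [z^-1] sends [z] and [1] = 0 to 0 and [z^-1], so it carries the central
    difference z - 0 to [-z^-1]. *)
Lemma add_center_inv (X : groupType) (B : skew_brace X) (z : X) :
  right_distributor B z -> add_center B z -> add_center B z^-1.
Proof.
move=> Dz Cz.
have bij : bijective (fun x : X => x * z^-1).
  by exists (fun x => x * z) => x; [exact: mulgVK | exact: mulgK].
have := heap_morphism_center X B _ z 1 bij (heap_morphism_mulrV X B z Dz).
rewrite mulgV mul1g -(sb_zeroE X B) sb_add0.
have -> : z -[B] sb_zero B = z.
  by rewrite - [X in X -[B] _](sb_addr0 X B) sb_addrK.
by move=> /(_ Cz)/(add_center_opp X B); rewrite sb_oppK.
Qed.

Theorem proposition3p15 (X : groupType) (Y : set X)
    (tri sigma tau : Y -> Y -> X -> X -> X)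
    (h : Y -> Y -> Y) (bullet : Y -> Y -> X -> X -> X)
    (tri_shelf : p_shelf tri)
    (sigma_bij : forall (zi zj : Y) (a : X), bijective (sigma zi zj a))
    (tauE : forall (zi zj : Y) (a b : X),
       tau zi zj b a =
       inv_map (sigma zj zi (sigma zi zj a b)) (tri zi zj (sigma zi zj a b) a))
    (mul_sigma_tau : forall (zi zj : Y) (a b : X),
       a * b = sigma zi zj a b * tau zi zj b a)
    (h_sym : forall zi zj : Y, h zi zj = h zj zi)
    (bulletE : forall (zi zj : Y) (a b : X),
       bullet zj zi a b = a * inv_map (sigma zi zj a) b * val (h zi zj)) :
  ((forall (zi zj : Y) (a b : X),
      bullet zj zi a b = bullet zi zj b (tri zi zj b a)) /\
   (forall (zi zj : Y) (a b : X),
      bullet zj zi a (sigma zi zj a b) = a * b * val (h zi zj))) /\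
  (forall (B : skew_brace X)
     (Y_sub : Y `<=` right_distributor B `&` add_center B)
     (Y_comm : forall zi zj : Y, val zi * val zj = val zj * val zi)
     (bullet_add : forall (zi zj : Y) (a b : X),
        bullet zi zj a b = a * val zi +[B] b * val zj)
     (h_mul : forall zi zj : Y, val (h zi zj) = val zi * val zj),
     ((forall (zi zj : Y) (a b : X),
         tri zi zj b a =
         -[B] (b * val zi * (val zj)^-1) +[B] a +[B] b * val zi * (val zj)^-1) /\
      (forall (zi zj : Y) (a b : X),
         sigma zi zj a b =
         (val zi)^-1 -[B] a * (val zi)^-1 * val zj +[B] a * b * val zj)) /\
     ((forall (zi zj zk : Y) (a b c : X),
         sigma zi zk a (sigma zi zj b c) =
         sigma zi zj (sigma zj zk a b) (sigma zi zk (tau zj zk b a) c)) /\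
      (forall (zi zj zk : Y) (a b c : X),
         tri zi zj (sigma zi zk c b) (sigma zj zk c a) =
         sigma zj zk c (tri zi zj b a)) /\
      admissible_twist tri (twist_map sigma))).
Proof.
have sK zi zj a := inv_mapK (sigma_bij zi zj a).
have part1a zi zj a b : bullet zj zi a b = bullet zi zj b (tri zi zj b a).
  (* What remains is the factorisation of [a * b'] through [sigma] and [tau], at the preimage [b']
     of [b] under [sigma zi zj a]. *)
  rewrite !bulletE h_sym; congr (_ * _).
  by rewrite (mul_sigma_tau zi zj) tauE (sK zi zj a).2.
have part1b zi zj a b :
    bullet zj zi a (sigma zi zj a b) = a * b * val (h zi zj).
  by rewrite bulletE (sK zi zj a).1.
split=> // B Y_sub Y_comm bullet_add h_mul.
have D (z : Y) : right_distributor B (val z) by case: (Y_sub _ (set_valP z)).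
have C (z : Y) : add_center B (val z)^-1.
  by apply: add_center_inv; case: (Y_sub _ (set_valP z)).
have mrz (z : Y) := heap_morphism_mulr X B _ (D z).
have mrV (z : Y) := heap_morphism_mulrV X B _ (D z).
have Y_commV (zi zj : Y) : (val zi)^-1 * val zj = val zj * (val zi)^-1.
  by apply: (mulgI (val zi)); rewrite mulVKg mulgA Y_comm mulgK.
have triE zi zj a b : tri zi zj b a =
    -[B] (b * val zi * (val zj)^-1) +[B] a +[B] b * val zi * (val zj)^-1.
  have := part1a zi zj a b; rewrite !bullet_add => e.
  (* Padding with [1], the additive zero, makes this an iterated heap expression, over which right
     multiplication by the inverse of [zj] distributes; the two central terms so created cancel. *)
  have {}e : tri zi zj b a * val zj =
      1 -[B] b * val zi +[B] a * val zj -[B] 1 +[B] b * val zi.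
    apply: (sb_addrI X B (b * val zi)).
    by rewrite -e -(sb_zeroE X B) !sb_addE.
  rewrite - [LHS](mulgK (val zj)) e !mrV mul1g mulgK.
  by rewrite -(sb_addA B (val zj)^-1) -(sb_addA B (val zj)^-1) C !sb_addE.
have sigmaE zi zj a b : sigma zi zj a b =
    (val zi)^-1 -[B] a * (val zi)^-1 * val zj +[B] a * b * val zj.
  have := part1b zi zj a b; rewrite bullet_add h_mul Y_comm => e.
  have {}e : sigma zi zj a b * val zi =
      1 -[B] a * val zj +[B] a * b * val zj * val zi.
    apply: (sb_addrI X B (a * val zj)).
    by rewrite e -(sb_zeroE X B) !sb_addE !mulgA.
  rewrite - [LHS](mulgK (val zi)) e mrV mul1g mulgK.
  by rewrite -!(mulgA a) Y_commV.
(* The composite depends on [a], [b] only through [a * b] and on [zj], [zk] only through their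
   product, whence the first twist identity. *)
have sigma2E zi zj zk a b c : sigma zi zk a (sigma zi zj b c) =
    (val zi)^-1 -[B] a * b * (val zi)^-1 * (val zj * val zk)
      +[B] a * b * c * (val zj * val zk).
  rewrite !sigmaE heap_morphism_mull mrz !mulgA.
  by rewrite !sb_addE.
have YB zi zj zk a b c : sigma zi zk a (sigma zi zj b c) =
    sigma zi zj (sigma zj zk a b) (sigma zi zk (tau zj zk b a) c).
  by rewrite !sigma2E -!mul_sigma_tau Y_comm.
have sigma_tri zi zj zk a b c : tri zi zj (sigma zi zk c b) (sigma zj zk c a) =
    sigma zj zk c (tri zi zj b a).
  pose u := (val zj)^-1; pose w := b * val zi * u.
  pose f x := c * x * val zk.
  have hf : heap_morphism X B f.
    exact: heap_morphism_comp (heap_morphism_mull X B c) (mrz zk).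
  have f_bij : bijective f.
    by exists (fun x => c^-1 * (x * (val zk)^-1)) => x;
      rewrite /f ?mulgK ?mulKg // mulVKg mulgVK.
  have sigmaf x : sigma zj zk c x = u -[B] f u +[B] f x by rewrite sigmaE.
  (* Both triangles are conjugations: the right one by [w], the left one by this element, which is
     [sigma zj zk c w]. *)
  have Sw : sigma zi zk c b * val zi * (val zj)^-1 = u -[B] f u +[B] f w.
    rewrite sigmaE !mrz !mrV mulVg mul1g /f /w /u.
    rewrite -!(mulgA c _ (val zk)) !Y_commV !mulgA mulgVK.
    congr (_ +[B] _).
    rewrite -(mulgA (c * b) (val zk)) Y_comm -(mulgA _ (val zj)^-1 (val zk)).
    by rewrite Y_commV !mulgA.
  (* u is central but f u need not be; only the difference f 1 - f u is. *)
  have Ck : add_center B (f 1 -[B] f u).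
    apply: heap_morphism_center => //.
    by rewrite -(sb_zeroE X B) sb_add0; apply: add_center_opp; exact: C.
  (* Such a conjugate by [f 1] appears once [f] is distributed over the padded form of -w + a + w,
     since [f] need not fix [1]. *)
  have f_conj s : -[B] (f u) +[B] f 1 +[B] s -[B] f 1 = s -[B] f u.
    have -> : -[B] (f u) +[B] f 1 = f 1 -[B] f u.
      by apply: (sb_addrI X B (f u)); rewrite -Ck !sb_addE.
    by rewrite Ck -(sb_addA B s) Ck !sb_addE.
  rewrite !triE Sw !sigmaf -/u -/w.
  have -> : -[B] w +[B] a +[B] w = 1 -[B] w +[B] a -[B] 1 +[B] w.
    by rewrite -(sb_zeroE X B) !sb_addE.
  rewrite !hf.
  (* Regrouped for [f_conj], which eliminates [f 1]; the two sides then differ only in the position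
     of the central [u]. *)
  have -> : u -[B] f u +[B] (f 1 -[B] f w +[B] f a -[B] f 1 +[B] f w) =
      u +[B] (-[B] (f u) +[B] f 1 +[B] (-[B] (f w) +[B] f a) -[B] f 1) +[B] f w.
    by rewrite !sb_addE.
  by rewrite f_conj (sb_addA B u) (C zj (_ +[B] f a)) !sb_addE.
do 3![split; first by []].
exists sigma; split=> // zi zj zk a b c.
by rewrite YB tauE.
Qed.
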